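(* Let $\alpha$ be a positive integer, let $a,b,\beta>0$ and $x\in(0,1)$. Then $$ \frac{\psi_{a,b,\alpha,\beta}(x)}{x^{2a+\alpha+\beta}(1-x)^{2b}} =\sum_{j=0}^{\alpha-1}\frac{\Gamma(a+b+j)\,\Gamma(a+b+\beta+\alpha-j-1)}{[\Gamma(b)]^2\,\Gamma(a+j+1)\,\Gamma(a+\beta+\alpha-j)}\,D_j(x), $$ where $$ D_j(x)=\frac{a+b+j}{a+j+1}\,{}_2F_1(1,a+b+j+1;\,a+j+2;\,x)-\frac{a+b+\beta+\alpha-1-j}{a+\beta+\alpha-j}\,{}_2F_1(1,a+b+\beta+\alpha-j;\,a+\beta+\alpha-j+1;\,x). $$
   Context: For $a,b>0$ and $x\in(0,1)$, $I_x(a,b)=\dfrac{\int_0^x t^{a-1}(1-t)^{b-1}dt}{\int_0^1 t^{a-1}(1-t)^{b-1}dt}$ is the normalized incomplete beta function. For $a,b,\alpha,\beta>0$ put $$\psi_{a,b,\alpha,\beta}(x)=I_x(a+\alpha,b)\,I_x(a+\beta,b)-I_x(a,b)\,I_x(a+\alpha+\beta,b).$$ ${}_2F_1(p,q;r;x)=\sum_{n=0}^\infty \frac{(p)_n(q)_n}{(r)_n\,n!}x^n$ is the Gauss hypergeometric function, where $(p)_0=1$ and $(p)_n=p(p+1)\cdots(p+n-1)$ is the Pochhammer symbol. *)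

(* Defs.v *)
From HB Require Import structures.
From mathcomp Require Import all_boot all_order all_algebra.
From mathcomp Require Import all_classical all_reals all_analysis.
Import Order.TTheory GRing.Theory Num.Theory.
Import numFieldNormedType.Exports.

Set Implicit Arguments.
Unset Strict Implicit.
Unset Printing Implicit Defensive.

Local Open Scope classical_set_scope.
Local Open Scope ring_scope.

(* Lebesgue integrals of nonnegative functions, hence the classical (possibly
   improper) integrals; [Rintegral] is a default value when the integral
   diverges, which does not happen for s > 0, resp. for a, b > 0, x <= 1. *)
Definition Gamma (R : realType) (s : R) : R :=
  \int[@lebesgue_measure R]_(t in `]0%R, +oo[) (t `^ (s - 1) * expR (- t)).

Definition beta_integral (R : realType) (a b x : R) : R :=
  \int[@lebesgue_measure R]_(t in `]0%R, x[)
    (t `^ (a - 1) * (1 - t) `^ (b - 1)).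

Definition reg_inc_beta (R : realType) (a b x : R) : R :=
  beta_integral a b x / beta_integral a b 1.

Definition psi (R : realType) (a b alpha beta x : R) : R :=
  reg_inc_beta (a + alpha) b x * reg_inc_beta (a + beta) b x
  - reg_inc_beta a b x * reg_inc_beta (a + alpha + beta) b x.

Definition pochhammer (R : realType) (p : R) (n : nat) : R :=
  \prod_(0 <= k < n) (p + k%:R).

(* Meaningful when r is not a nonpositive integer and the series converges,
   in particular for `|x| < 1. *)
Definition hyp2F1 (R : realType) (p q r x : R) : R :=
  limn (pseries
    (fun n => pochhammer p n * pochhammer q n / (pochhammer r n * n`!%:R)) x).

Definition D_term (R : realType) (a b alpha beta : R) (j : nat) (x : R) : R :=
  (a + b + j%:R) / (a + j%:R + 1)
    * hyp2F1 1 (a + b + j%:R + 1) (a + j%:R + 2) x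
  - (a + b + beta + alpha - 1 - j%:R) / (a + beta + alpha - j%:R)
    * hyp2F1 1 (a + b + beta + alpha - j%:R) (a + beta + alpha - j%:R + 1) x.

(* Main.v *)
Require Import Defs.
From HB Require Import structures.
From mathcomp Require Import all_boot all_order all_algebra.
From mathcomp Require Import all_classical all_reals all_analysis.
From mathcomp Require Import interval_inference measurable_realfun ring lra.
Import Order.TTheory GRing.Theory Num.Theory.
Import numFieldNormedType.Exports.

Local Open Scope classical_set_scope.
Local Open Scope ring_scope.

(** With p = a + j and u = a + beta + alpha - 1 - j, the numerator telescopes:
    psi is the sum over j of I(p + 1) I(u) - I(p) I(u + 1), where
    I(p) = I_x(p, b).  Integration by parts gives
    p B_x(p, b) = (p + b) B_x(p + 1, b) + x^p (1 - x)^b, that is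
    I(p) = I(p + 1) + K(p) x^p (1 - x)^b with
    K(p) = Gamma(p + b) / (Gamma(p + 1) Gamma(b)).  Iterating the recurrence
    expresses p B_x(p, b) as x^p (1 - x)^b 2F1(1, p + b; p + 1; x), so both
    factors of each difference become explicit and the products of the two
    hypergeometric functions cancel. *)

(** * Affine change of variables on the real line *)

Lemma ge0_integral_affine (R : realType) (h : R -> \bar R) (c d : R) :
  0 < c -> measurable_fun [set: R] h -> (forall y, 0 <= h y)%E ->
  (\int[lebesgue_measure]_y h y =
   c%:E * \int[lebesgue_measure]_y h (c * y + d)%R)%E.
Proof.
move=> c0 mh h0.
pose phi (y : measurableTypeR R) : measurableTypeR R := c * y + d.
have mphi : measurable_fun [set: measurableTypeR R] phi.
  by apply: measurable_funD => //; exact: measurable_funM.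
(* The preimage of an interval under [phi] is shorter by the factor [c]; rescaling the pushforward
   by [c] restores the length, and Lebesgue measure is determined by its values on intervals. *)
pose nu : {measure set (measurableTypeR R) -> \bar R} :=
  mscale (NngNum (ltW c0)) (pushforward (@lebesgue_measure R) phi).
have nuE A : measurable A -> lebesgue_measure A = nu mphi A.
  apply: lebesgue_measure_unique => _ [[u v]] _ <- /=.
  rewrite /mscale /pushforward /=.
  pose J := `](u - d) / c, (v - d) / c]%classic.
  have E : phi @^-1` `]u, v]%classic = J.
    apply/seteqP; split => y; rewrite /J /= !in_itv /phi /J /=.
      by rewrite ltr_pdivrMr// ler_pdivlMr// ltrBlDr lerBrDr (mulrC y).
    by rewrite ltr_pdivrMr// ler_pdivlMr// ltrBlDr lerBrDr (mulrC y).
  transitivity (c%:E * lebesgue_measure J)%E; last by rewrite -E.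
  rewrite !lebesgue_measure_itv /= !lte_fin ltr_pM2r ?invr_gt0// ltrD2r.
  case: ifPn => _; last by rewrite mule0.
  by rewrite -!EFinB -EFinM; congr EFin; field; rewrite gt_eqF.
rewrite (@eq_measure_integral _ _ _ _ (nu mphi)); last by move=> A mA _; exact: nuE.
rewrite ge0_integral_mscale//=; congr (_ * _)%E.
by rewrite ge0_integral_pushforward.
Qed.

(** * The product formula relating the Gamma and beta integrals *)

Section beta_gamma.
Context {R : realType}.
Local Notation mu := (@lebesgue_measure R).
Implicit Types a b s t v : R.

(** Values are kept in the extended reals so that Tonelli and linearity for nonnegative integrands
    apply before finiteness is known. *)
Definition ext_Gamma a : \bar R :=
  (\int[mu]_(t in `]0%R, +oo[) (t `^ (a - 1) * expR (- t))%:E)%E.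

Definition ext_beta a b x : \bar R :=
  (\int[mu]_(t in `]0%R, x[) (t `^ (a - 1) * (1 - t) `^ (b - 1))%:E)%E.

(** The cutoff turns Gamma and beta integrals into integrals over the whole line, so substitutions
    leave the domain alone. It must be explicit because [powR] does not vanish on negative bases. *)
Definition pos_powR a t : R := t `^ (a - 1) * \1_`]0, +oo[%classic t.

Lemma pos_powR_ge0 a t : 0 <= pos_powR a t.
Proof. by rewrite mulr_ge0// powR_ge0. Qed.

Lemma pos_powR_gt0E a t : 0 < t -> pos_powR a t = t `^ (a - 1).
Proof. by move=> t0; rewrite /pos_powR indicE mem_set ?mulr1//= in_itv/= t0. Qed.

Lemma pos_powR_le0E a t : t <= 0 -> pos_powR a t = 0.
Proof.
move=> t0; rewrite /pos_powR indicE memNset ?mulr0//= in_itv/= andbT.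
by apply/negP; rewrite -leNgt.
Qed.

Lemma measurable_pos_powR a : measurable_fun [set: R] (pos_powR a).
Proof. by apply: measurable_funM; [exact: measurable_powR|exact: measurable_indic]. Qed.

Lemma pos_powRM a v t : 0 < v -> pos_powR a (v * t) = v `^ (a - 1) * pos_powR a t.
Proof.
move=> v0; have [t0|t0] := ltP 0 t.
  by rewrite !pos_powR_gt0E ?mulr_gt0// powRM// ltW.
by rewrite !pos_powR_le0E ?mulr0// pmulr_rle0.
Qed.

Lemma ext_GammaE a :
  ext_Gamma a = (\int[mu]_t (pos_powR a t * expR (- t))%:E)%E.
Proof.
rewrite /ext_Gamma integral_mkcond; apply: eq_integral => t _; rewrite patchE.
case: ifPn => [|t0].
  by rewrite inE/= in_itv/= andbT => t0; rewrite pos_powR_gt0E.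
rewrite pos_powR_le0E ?mul0r// leNgt; apply: contra t0 => t0.
by rewrite inE/= in_itv/= t0.
Qed.

Lemma ext_betaE a b :
  ext_beta a b 1 = (\int[mu]_t (pos_powR a t * pos_powR b (1 - t))%:E)%E.
Proof.
rewrite /ext_beta integral_mkcond; apply: eq_integral => t _; rewrite patchE.
case: ifPn => [|t0].
  rewrite inE/= in_itv/= => /andP[t0 t1].
  by rewrite !pos_powR_gt0E ?subr_gt0.
have [t1|t1] := leP 1 t; first by rewrite (pos_powR_le0E b) ?mulr0// subr_le0.
rewrite (pos_powR_le0E a) ?mul0r// leNgt; apply: contra t0 => t0.
by rewrite inE/= in_itv/= t0.
Qed.

(** The integrand s^(a-1) (v-s)^(b-1) e^(-v) on 0 < s < v: the v-integral first yields Gamma(a)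
    Gamma(b), the s-integral first yields Gamma(a+b) B(a,b). *)
Let conv_kernel a b (p : R * R) : R :=
  pos_powR a p.1 * pos_powR b (p.2 - p.1) * expR (- p.2).

Let measurable_conv_kernel a b :
  measurable_fun setT (fun p : R * R => (conv_kernel a b p)%:E).
Proof.
apply/measurable_EFinP; apply: measurable_funM; first apply: measurable_funM.
- apply: (measurableT_comp (measurable_pos_powR a)).
  exact: measurable_fst.
- apply: (measurableT_comp (measurable_pos_powR b)).
  exact: measurable_funB measurable_snd measurable_fst.
- apply: measurableT_comp => //.
  exact: measurableT_comp measurable_snd.
Qed.

Let measurable_conv_kernel1 a b v :
  measurable_fun [set: R] (fun s : R => (conv_kernel a b (s, v))%:E).
Proof.
apply/measurable_EFinP.
rewrite (_ : (fun _ => _) = (fun s : R => pos_powR a s * pos_powR b (v - s) * expR (- v)))//.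
apply: measurable_funM; last exact: measurable_cst.
apply: measurable_funM; first exact: measurable_pos_powR.
apply: (measurableT_comp (measurable_pos_powR b) (g := fun s : R => v - s)).
exact: measurable_funB.
Qed.

Let conv_kernel_ge0 a b p : 0 <= conv_kernel a b p.
Proof.
by apply: mulr_ge0; [apply: mulr_ge0; exact: pos_powR_ge0|exact: expR_ge0].
Qed.

Lemma ext_Gamma_ge0 a : (0 <= ext_Gamma a)%E.
Proof. by apply: integral_ge0 => t _; rewrite lee_fin mulr_ge0 ?powR_ge0 ?expR_ge0. Qed.

Lemma ext_beta_ge0 a b x : (0 <= ext_beta a b x)%E.
Proof. by apply: integral_ge0 => t _; rewrite lee_fin mulr_ge0 ?powR_ge0. Qed.

Lemma measurable_Gamma_integrand a :
  measurable_fun [set: R] (fun t : R => (pos_powR a t * expR (- t))%:E).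
Proof.
apply/measurable_EFinP; apply: measurable_funM; first exact: measurable_pos_powR.
by apply: measurableT_comp.
Qed.

Lemma measurable_beta_integrand a b :
  measurable_fun [set: R] (fun t : R => (pos_powR a t * pos_powR b (1 - t))%:E).
Proof.
apply/measurable_EFinP; apply: measurable_funM; first exact: measurable_pos_powR.
by apply: (measurableT_comp (measurable_pos_powR b)); exact: measurable_funB.
Qed.

(* Tonelli, after substituting t = v - s in the inner integral and then s = v w. *)
Lemma ext_Gamma_mul a b :
  (ext_Gamma a * ext_Gamma b = ext_Gamma (a + b) * ext_beta a b 1)%E.
Proof.
transitivity (\int[mu]_s \int[mu]_v (conv_kernel a b (s, v))%:E)%E.
  rewrite [in LHS]ext_GammaE -ge0_integralZr//; last 3 first.
  - exact: measurable_Gamma_integrand.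
  - by move=> t _; rewrite lee_fin mulr_ge0 ?pos_powR_ge0 ?expR_ge0.
  - exact: ext_Gamma_ge0.
  apply: eq_integral => s _.
  rewrite ext_GammaE (@ge0_integral_affine _ _ 1 (- s)) ?ltr01 ?mul1e//; last 2 first.
  - exact: measurable_Gamma_integrand.
  - by move=> t; rewrite lee_fin mulr_ge0 ?pos_powR_ge0 ?expR_ge0.
  rewrite -ge0_integralZl//; last 3 first.
  - apply: (measurableT_comp (measurable_Gamma_integrand b)).
    by apply: measurable_funD => //; exact: measurable_funM.
  - by move=> t _; rewrite lee_fin mulr_ge0 ?pos_powR_ge0 ?expR_ge0.
  - by rewrite lee_fin mulr_ge0 ?pos_powR_ge0 ?expR_ge0.
  apply: eq_integral => v _; rewrite -EFinM; congr EFin.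
  rewrite /conv_kernel /= mul1r mulrACA -expRD; congr (_ * expR _); ring.
transitivity (\int[mu]_v \int[mu]_s (conv_kernel a b (s, v))%:E)%E.
  apply: (@fubini_tonelli _ _ _ _ R mu mu (fun p : R * R => (conv_kernel a b p)%:E)).
    exact: measurable_conv_kernel.
  by move=> p; rewrite lee_fin.
rewrite [in RHS]ext_GammaE -ge0_integralZr//; last 3 first.
- exact: measurable_Gamma_integrand.
- by move=> t _; rewrite lee_fin mulr_ge0 ?pos_powR_ge0 ?expR_ge0.
- exact: ext_beta_ge0.
(* For v <= 0 both sides vanish, since s and v - s cannot both be positive. *)
apply: eq_integral => v _; have [v0|v0] := leP v 0.
  rewrite (pos_powR_le0E (a + b) v v0) mul0r mul0e integral0_eq// => s _.
  rewrite /conv_kernel/=; have [s0|s0] := leP s 0.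
    by rewrite pos_powR_le0E ?mul0r.
  rewrite (pos_powR_le0E b) ?mulr0 ?mul0r//; lra.
rewrite (@ge0_integral_affine _ _ v 0 v0); last 2 first.
- exact: measurable_conv_kernel1.
- by move=> s; rewrite lee_fin.
rewrite ext_betaE -ge0_integralZl//; last 3 first.
- apply: (measurableT_comp (measurable_conv_kernel1 a b v)).
  by apply: measurable_funD => //; exact: measurable_funM.
- by move=> s _; rewrite lee_fin.
- by rewrite lee_fin ltW.
rewrite -ge0_integralZl//; last 3 first.
- exact: measurable_beta_integrand.
- by move=> t _; rewrite lee_fin mulr_ge0 ?pos_powR_ge0.
- by rewrite lee_fin mulr_ge0 ?pos_powR_ge0 ?expR_ge0.
apply: eq_integral => w _; rewrite -!EFinM; congr EFin.
rewrite /conv_kernel/= addr0 (_ : v - v * w = v * (1 - w)); last by ring.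
(* The single factor v is the Jacobian of s = v w; the two powers come from homogeneity of the
   kernel. *)
have -> : pos_powR (a + b) v = v * v `^ (a - 1) * v `^ (b - 1).
  rewrite pos_powR_gt0E// (_ : a + b - 1 = 1 + (a - 1) + (b - 1)); last by ring.
  by rewrite !powRD ?(lt0r_neq0 v0) ?implybT// powRr1// ltW.
rewrite !pos_powRM//; ring.
Qed.

End beta_gamma.

(** * A fundamental theorem of calculus on open intervals, for integrands that may be singular at
    the endpoints *)

Section improper_FTC.
Context {R : realType}.
Local Notation mu := (@lebesgue_measure R).
Variables (f g F : R -> R) (a b : R).
Hypothesis ab : a < b.
Hypothesis f0 : {in `]a, b[, forall t, 0 <= f t}.
Hypothesis g0 : {in `]a, b[, forall t, 0 <= g t}.
Hypothesis cf : {in `]a, b[, continuous f}.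
Hypothesis cg : {in `]a, b[, continuous g}.
Hypothesis dF : {in `]a, b[, forall t, is_derive t (1 : R) F (f t - g t)}.
Hypothesis Fa : F x @[x --> a^'+] --> F a.
Hypothesis Fb : F x @[x --> b^'-] --> F b.

(** The factor 1/3 keeps [p n < q n] already at n = 0, where [harmonic] equals 1. *)
Let r n : R := (b - a) / 3 * harmonic n.
Let p n := a + r n.
Let q n := b - r n.

Let r_gt0 n : 0 < r n.
Proof. by rewrite mulr_gt0 ?harmonic_gt0// divr_gt0// subr_gt0. Qed.

Let r_le m n : (m <= n)%N -> r n <= r m.
Proof.
move=> mn; rewrite ler_pM2l ?divr_gt0 ?subr_gt0//.
by rewrite lef_pV2 ?posrE// ler_nat.
Qed.

Let r_lt n : r n <= (b - a) / 3.
Proof. by apply: le_trans (r_le 0 n isT) _; rewrite /r /= invr1 mulr1. Qed.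

Let cvg_r : r n @[n --> \oo] --> 0.
Proof. by rewrite -(mulr0 ((b - a) / 3)); apply: cvgMr cvg_harmonic. Qed.

Let cvg_p : p n @[n --> \oo] --> a.
Proof. by rewrite -[X in _ --> X]addr0; apply: cvgD cvg_r; exact: cvg_cst. Qed.

Let cvg_q : q n @[n --> \oo] --> b.
Proof. by rewrite -[X in _ --> X]subr0; apply: cvgB cvg_r; exact: cvg_cst. Qed.

Let pq_bounds n : [/\ a < p n, p n < q n & q n < b].
Proof. by have := r_gt0 n; have := r_lt n; rewrite /p /q; split; lra. Qed.

Let pq_sub n : `[p n, q n]%classic `<=` `]a, b[%classic.
Proof.
have [ap _ qb] := pq_bounds n.
move=> t /=; rewrite !in_itv/= => /andP[pt tq].
by rewrite (lt_le_trans ap pt) (le_lt_trans tq qb).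
Qed.

Let nondecreasing_pq : nondecreasing_seq (fun n => `[p n, q n]%classic).
Proof.
move=> m n mn; rewrite subsetEset => t /=; rewrite !in_itv/= => /andP[pt tq].
have rmn := r_le m n mn; rewrite /p /q in pt tq *; apply/andP; split; lra.
Qed.

Let bigcup_pq : \bigcup_n `[p n, q n]%classic = `]a, b[%classic.
Proof.
apply/seteqP; split => [t [n _]|t /=]; first exact: pq_sub.
rewrite in_itv/= => /andP[at_ tb].
have /cvgrPdist_lt/(_ (Num.min (t - a) (b - t))) := cvg_r.
rewrite lt_min !subr_gt0 at_ tb => /(_ isT)[n _ /(_ n (leqnn n))] /=.
rewrite sub0r normrN gtr0_norm// lt_min => /andP[ra rb].
by exists n => //=; rewrite in_itv/= /p /q; apply/andP; split; lra.
Qed.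

Let cvg_integral_pq (h : R -> R) :
  {in `]a, b[, forall t, 0 <= h t} -> {in `]a, b[, continuous h} ->
  (\int[mu]_(t in `[p n, q n]) (h t)%:E)%E @[n --> \oo] -->
  (\int[mu]_(t in `]a, b[) (h t)%:E)%E.
Proof.
move=> h0 ch; rewrite -bigcup_pq.
apply: ge0_nondecreasing_set_cvg_integral => //.
- move=> n; apply/measurable_EFinP; apply: measurable_funS (pq_sub n) _ => //.
  apply: open_continuous_measurable_fun => //.
  by move=> t; rewrite inE => tab; exact: ch.
- by move=> n t /pq_sub tab; rewrite lee_fin h0.
Qed.

Let integrable_pq (h : R -> R) n : {in `]a, b[, continuous h} ->
  mu.-integrable `[p n, q n] (EFin \o h).
Proof.
move=> ch; apply: continuous_compact_integrable; first exact: segment_compact.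
by apply: continuous_in_subspaceT => t; rewrite inE => /pq_sub; exact: ch.
Qed.

(** On a compact subinterval both integrals are finite, so the usual formula for f - g can be
    rearranged into a subtraction-free one. *)
Let FTC_pq n :
  (\int[mu]_(t in `[p n, q n]) (f t)%:E + (F (p n))%:E =
   \int[mu]_(t in `[p n, q n]) (g t)%:E + (F (q n))%:E)%E.
Proof.
have [ap pq qb] := pq_bounds n.
have dFc t : t \in `]a, b[ -> {for t, continuous F}.
  by move=> /dF Ft; apply/differentiable_continuous/derivable1_diffP.
have pab : p n \in `]a, b[ by rewrite in_itv/= ap (lt_trans pq).
have qab : q n \in `]a, b[ by rewrite in_itv/= qb (lt_trans ap).
have pq_oo t : t \in `]p n, q n[ -> t \in `]a, b[.
  by rewrite !in_itv/= => /andP[pt tq]; rewrite (lt_trans ap pt) (lt_trans tq qb).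
have If := integrable_pq f n cf; have Ig := integrable_pq g n cg.
have : (\int[mu]_(t in `[p n, q n]) (f t - g t)%:E = (F (q n))%:E - (F (p n))%:E)%E.
  apply: continuous_FTC2 => //.
  - apply: continuous_in_subspaceT => t; rewrite inE => /pq_sub tab.
    by apply: continuousB; [exact: cf|exact: cg].
  - split.
    + by move=> t /pq_oo/dF Ft; exact: ex_derive.
    + exact/cvg_at_right_filter/dFc.
    + exact/cvg_at_left_filter/dFc.
  - by move=> t /pq_oo/dF Ft; rewrite derive1E derive_val.
under eq_integral do rewrite EFinB.
rewrite integralB// => E.
have Jf : (\int[mu]_(t in `[p n, q n]) (f t)%:E)%E \is a fin_num.
  by apply: (integrable_fin_num _ If).
have Jg : (\int[mu]_(t in `[p n, q n]) (g t)%:E)%E \is a fin_num.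
  by apply: (integrable_fin_num _ Ig).
move: E; rewrite -(fineK Jf) -(fineK Jg).
by rewrite -!EFinB -!EFinD => -[E]; congr EFin; lra.
Qed.

(** Monotone convergence along the compact intervals exhausting ]a, b[. Splitting the derivative
    into nonnegative f and g, one on each side, makes the identity meaningful even when an integral
    is infinite. *)
Lemma ge0_improper_FTC :
  (\int[mu]_(t in `]a, b[) (f t)%:E + (F a)%:E =
   \int[mu]_(t in `]a, b[) (g t)%:E + (F b)%:E)%E.
Proof.
have Fp : (F (p n))%:E @[n --> \oo] --> (F a)%:E.
  apply: cvg_EFin; first exact: nearW.
  by move/cvg_at_rightP : Fa; apply; split => // n; have [] := pq_bounds n.
have Fq : (F (q n))%:E @[n --> \oo] --> (F b)%:E.
  apply: cvg_EFin; first exact: nearW.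
  by move/cvg_at_leftP : Fb; apply; split => // n; have [] := pq_bounds n.
have L := cvgeD (fin_num_adde_defl _ _) (cvg_integral_pq f f0 cf) Fp.
have M := cvgeD (fin_num_adde_defl _ _) (cvg_integral_pq g g0 cg) Fq.
rewrite -(cvg_lim _ (L _ isT))// -(cvg_lim _ (M _ isT))//.
by congr (limn _); apply/funext => n; exact: FTC_pq.
Qed.

End improper_FTC.

(** * Integration by parts for the incomplete beta integral, and special values *)

Section beta_recurrence.
Context {R : realType}.
Local Notation mu := (@lebesgue_measure R).
Implicit Types a b p t x : R.

Lemma cvg_powR_at_right0 p : 0 < p -> t `^ p @[t --> (0 : R)^'+] --> (0 : R) `^ p.
Proof. by move=> p0; rewrite powR0 ?gt_eqF//; exact: powR_cvg0. Qed.

Lemma continuous_powR p t : 0 < t -> {for t, continuous (@powR R ^~ p)}.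
Proof.
move=> t0; apply/differentiable_continuous/derivable1_diffP.
by apply: derivable_powR; rewrite in_itv/= t0.
Qed.

Lemma continuous_powR_onem b t : t < 1 -> {for t, continuous (fun t => (1 - t) `^ b)}.
Proof.
move=> t1; apply: (@continuous_comp _ _ _ (fun t => 1 - t) (@powR R ^~ b)).
  by apply: cvgB; [exact: cvg_cst|exact: cvg_id].
by apply: continuous_powR; rewrite subr_gt0.
Qed.

Lemma cvg_powR_onem_at_left b x : 0 < b -> x <= 1 ->
  (1 - t) `^ b @[t --> x^'-] --> (1 - x) `^ b.
Proof.
move=> b0; rewrite le_eqVlt => /predU1P[->|x1]; last first.
  exact/cvg_at_left_filter/continuous_powR_onem.
(* At x = 1 the base 1 - t tends to 0 from the right, where only one-sided continuity of the power
   is available. *)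
rewrite subrr; apply/cvg_at_leftP => u [u1 cu].
move/cvg_at_rightP : (cvg_powR_at_right0 b b0); apply; split.
  by move=> n; rewrite subr_gt0.
by rewrite -[X in _ --> X](subrr 1); apply: cvgB => //; exact: cvg_cst.
Qed.

(** Writing (1-t)^b = (1-t) (1-t)^(b-1) in the product rule gives a difference of two nonnegative
    beta integrands, the shape that [ge0_improper_FTC] expects. *)
Lemma is_derive_beta_primitive p b t : 0 < p -> 0 < b -> 0 < t -> t < 1 ->
  is_derive t (1 : R) (fun t => t `^ p * (1 - t) `^ b)
    (p * (t `^ (p - 1) * (1 - t) `^ (b - 1))
     - (p + b) * (t `^ p * (1 - t) `^ (b - 1))).
Proof.
move=> p0 b0 t0 t1; have u0 : 0 < 1 - t by rewrite subr_gt0.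
have D1 := is_derive1_powR p t0.
have D2 : is_derive t (1 : R) (fun t => 1 - t) (0 - 1).
  by apply: is_deriveB.
have D3 := @is_derive1_comp R (@powR R ^~ b) (fun t => 1 - t) t _ _ (is_derive1_powR b u0) D2.
have := is_deriveM D1 D3.
move=> /(@is_derive_eq _ _ _ _ _ _ _ _); apply.
rewrite /GRing.scale /= /comp /=.
have -> : (1 - t) `^ b = (1 - t) * (1 - t) `^ (b - 1) by rewrite mulr_powRB1// ltW.
have -> : t `^ p = t * t `^ (p - 1) by rewrite mulr_powRB1// ltW.
ring.
Qed.

Lemma continuous_beta_integrand a b t : 0 < t -> t < 1 ->
  {for t, continuous (fun t => t `^ a * (1 - t) `^ b)}.
Proof.
by move=> t0 t1; apply: continuousM;
  [exact: continuous_powR|exact: continuous_powR_onem].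
Qed.

(** Integration by parts with primitive t^p (1-t)^b; its value at 0 vanishes because p > 0. *)
Lemma ext_beta_step p b x : 0 < p -> 0 < b -> 0 < x -> x <= 1 ->
  (p%:E * ext_beta p b x =
   (p + b)%:E * ext_beta (p + 1) b x + (x `^ p * (1 - x) `^ b)%:E)%E.
Proof.
move=> p0 b0 x0 x1.
have itvP t : t \in `]0, x[ -> 0 < t /\ t < 1.
  by rewrite in_itv/= => /andP[-> /lt_le_trans ->].
have mint c : measurable_fun `]0, x[ (fun t : R => (t `^ c * (1 - t) `^ (b - 1))%:E).
  apply/measurable_EFinP; apply: open_continuous_measurable_fun => // t.
  by rewrite inE => /itvP[t0 t1]; exact: continuous_beta_integrand.
have := @ge0_improper_FTC R (fun t => p * (t `^ (p - 1) * (1 - t) `^ (b - 1)))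
  (fun t => (p + b) * (t `^ p * (1 - t) `^ (b - 1)))
  (fun t => t `^ p * (1 - t) `^ b) 0 x x0.
have cMl c d : {in `]0, x[, continuous (fun t => c * (t `^ d * (1 - t) `^ (b - 1)))}.
  move=> t /itvP[t0 t1]; apply: cvgM; first exact: cvg_cst.
  exact: continuous_beta_integrand.
rewrite (powR0 (lt0r_neq0 p0)) mul0r adde0 => E.
rewrite /ext_beta -!ge0_integralZl//; last 6 first.
- exact: mint.
- by move=> t _; rewrite lee_fin mulr_ge0 ?powR_ge0.
- by rewrite lee_fin ltW// addr_gt0.
- exact: mint.
- by move=> t _; rewrite lee_fin mulr_ge0 ?powR_ge0.
- by rewrite lee_fin ltW.
under eq_integral do rewrite -EFinM.
under [in RHS]eq_integral do rewrite addrK -EFinM.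
apply: E.
- by move=> t _; rewrite !mulr_ge0 ?powR_ge0// ltW.
- by move=> t _; rewrite !mulr_ge0 ?powR_ge0// ltW// addr_gt0.
- exact: cMl.
- exact: cMl.
- by move=> t /itvP[t0 t1]; exact: is_derive_beta_primitive.
- rewrite -[X in _ --> X](mul0r ((1 - 0) `^ b)); apply: cvgM.
    exact: powR_cvg0.
  by apply/cvg_at_right_filter/continuous_powR_onem.
- apply: cvgM; last exact: cvg_powR_onem_at_left.
  by apply/cvg_at_left_filter/continuous_powR.
Qed.

(** The primitive is t^a. This value turns the product formula at b = 1 into the functional equation
    of Gamma. *)
Lemma ext_betaE1 a : 0 < a -> ext_beta a 1 1 = (a^-1)%:E.
Proof.
move=> a0.
have mint : measurable_fun (`]0, (1 : R)[%classic) (fun t : R => (t `^ (a - 1))%:E).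
  by apply/measurable_EFinP; apply: measurable_funTS; exact: measurable_powR.
have in01 t : t \in `]0, (1 : R)[ -> 0 < t by rewrite in_itv/= => /andP[].
have := @ge0_improper_FTC R (fun t => a * t `^ (a - 1)) (cst 0) (@powR R ^~ a) 0 1 ltr01.
rewrite (powR0 (lt0r_neq0 a0)) adde0 powR1 integral0 add0e => E.
have {E} : (a%:E * ext_beta a 1 1 = 1)%E.
  rewrite /ext_beta; under eq_integral do rewrite subrr powRr0 mulr1.
  rewrite -ge0_integralZl//; last 2 first.
  - by move=> t _; rewrite lee_fin powR_ge0.
  - by rewrite lee_fin ltW.
  under eq_integral do rewrite -EFinM.
  apply: E.
  - by move=> t _; rewrite mulr_ge0 ?powR_ge0// ltW.
  - by [].
  - move=> t /in01 t0; apply: cvgM; first exact: cvg_cst.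
    exact: continuous_powR.
  - by move=> t _; exact: cvg_cst.
  - by move=> t /in01 t0; rewrite subr0; exact: is_derive1_powR.
  - exact: powR_cvg0.
  - by apply/cvg_at_left_filter; have := @continuous_powR a 1 ltr01; rewrite /prop_for/continuous_at powR1.
move=> E; transitivity ((a^-1)%:E * (a%:E * ext_beta a 1 1))%E.
  by rewrite muleA -EFinM mulVf ?mul1e// lt0r_neq0.
by rewrite E mule1.
Qed.

Lemma ext_Gamma1 : ext_Gamma (1 : R) = 1%E.
Proof.
rewrite /ext_Gamma; under eq_integral do rewrite subrr powRr0 mul1r.
rewrite integral_itv_obnd_cbnd; last first.
  by apply/measurable_EFinP; apply: measurable_funTS; exact: measurableT_comp.
have cexpN : continuous (fun t : R => expR (- t)).
  move=> t; apply: (@continuous_comp _ _ _ (@GRing.opp R) expR); first exact: continuousN.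
  exact: continuous_expR.
have D (t : R) : is_derive t (1 : R) (fun t => - expR (- t)) (expR (- t)).
  have D0 : is_derive t (1 : R) (-%R : R -> R) (- 1) by exact: is_deriveN.
  have := is_deriveN (@is_derive1_comp R expR (-%R) t _ _ (is_derive_expR (- t)) D0).
  by move=> /(@is_derive_eq _ _ _ _ _ _ _ _); apply; ring.
rewrite (@ge0_continuous_FTC2y _ _ (fun t => - expR (- t)) 0 0).
- by rewrite oppr0 expR0 sub0e -EFinN opprK.
- by move=> t _; rewrite expR_ge0.
- exact: continuous_subspaceT.
- rewrite -[X in _ --> X]oppr0; apply: cvgN; exact: cvgr_expR.
- by move=> t _; exact: ex_derive.
- by apply: cvg_at_right_filter; apply: cvgN; exact: cexpN.
- by move=> t _; rewrite derive1E derive_val.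
Qed.

End beta_recurrence.

(** * Finiteness and positivity of Gamma, and transfer to real-valued integrals *)

Section Gamma_beta_values.
Context {R : realType}.
Local Notation mu := (@lebesgue_measure R).
Implicit Types a b p t x : R.

Lemma ext_Gamma_succ a : 0 < a -> ext_Gamma (a + 1) = (a%:E * ext_Gamma a)%E.
Proof.
move=> a0; have := ext_Gamma_mul a 1; rewrite ext_Gamma1 mule1 ext_betaE1// => ->.
by rewrite muleCA -EFinM mulfV ?mule1// lt0r_neq0.
Qed.

(** On [1, 2] one has 0 <= ln t <= 1, hence t^(a-1) >= e^(-|a-1|), while e^(-t) >= e^(-2). *)
Lemma ext_Gamma_gt0 a : (0 < ext_Gamma a)%E.
Proof.
have e12 : (0 : R) < expR (- `|a - 1|) * expR (- 2) by rewrite mulr_gt0 ?expR_gt0.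
apply: (@lt_le_trans _ _ (\int[mu]_(t in `[1%R, 2%R]) (expR (- `|a - 1|) * expR (- 2))%:E)%E).
  rewrite integral_cst//= lebesgue_measure_itv/= lte_fin ltrDl ltr01.
  by rewrite -EFinB -EFinM lte_fin mulr_gt0// subr_gt0 ltrDl ltr01.
have mG (A : set R) : measurable A ->
    measurable_fun A (fun t : R => (t `^ (a - 1) * expR (- t))%:E).
  move=> mA; apply/measurable_EFinP; apply: measurable_funTS.
  by apply: measurable_funM; [exact: measurable_powR|exact: measurableT_comp].
apply: (@le_trans _ _ (\int[mu]_(t in `[1%R, 2%R]) (t `^ (a - 1) * expR (- t))%:E)%E).
  apply: ge0_le_integral; first by [].
  - by move=> t _; rewrite lee_fin ltW.
  - exact: measurable_cst.
  - exact: mG.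
  move=> t; rewrite /= in_itv/= => /andP[t1 t2].
  have t0 : 0 < t by lra.
  rewrite lee_fin; apply: ler_pM; rewrite ?expR_ge0//; last by rewrite ler_expR; lra.
  rewrite /powR gt_eqF// ler_expR -[leRHS]opprK lerN2 -mulNr.
  apply: le_trans (ler_norm _) _; rewrite normrM normrN ler_piMr//.
  rewrite ger0_norm ?ln_ge0//.
  by have := @le_ln1Dx R (t - 1); rewrite (_ : 1 + (t - 1) = t); last ring; lra.
apply: ge0_subset_integral => //; first exact: mG.
  by move=> t _; rewrite lee_fin mulr_ge0 ?powR_ge0 ?expR_ge0.
by move=> t /=; rewrite !in_itv/= => /andP[t1 _]; rewrite andbT; lra.
Qed.

Lemma ext_Gamma_nat n : (ext_Gamma (n.+1%:R : R) < +oo)%E.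
Proof.
elim: n => [|n IH]; first by rewrite ext_Gamma1 ltry.
by rewrite -natr1 ext_Gamma_succ ?ltr0n//; apply: lte_mul_pinfty; rewrite ?lee_fin.
Qed.

(** For an integer n >= a, t^(a-1) is at most 1 when t <= 1 and at most t^n when t > 1, so the
    integral is bounded by Gamma(1) + Gamma(n+1). *)
Lemma ext_Gamma_ge1_lty a : 1 <= a -> (ext_Gamma a < +oo)%E.
Proof.
move=> a1; have [n an] : exists n : nat, a <= n%:R.
  by exists (Num.bound a); apply/ltW; rewrite archi_boundP//; lra.
apply: (@le_lt_trans _ _ (ext_Gamma 1 + ext_Gamma n.+1%:R)%E); last first.
  by rewrite lte_add_pinfty// ?ext_Gamma1 ?ltry//; exact: ext_Gamma_nat.
have mG c (A : set R) : measurable A ->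
    measurable_fun A (fun t : R => (t `^ c * expR (- t))%:E).
  move=> mA; apply/measurable_EFinP; apply: measurable_funTS.
  by apply: measurable_funM; [exact: measurable_powR|exact: measurableT_comp].
have G0 c t : (0 <= (t `^ c * expR (- t))%:E)%E.
  by rewrite lee_fin mulr_ge0 ?powR_ge0 ?expR_ge0.
rewrite /ext_Gamma -ge0_integralD//; [|exact: mG..].
apply: ge0_le_integral; first by [].
- by move=> t _; exact: G0.
- exact: mG.
- by apply: emeasurable_funD; exact: mG.
move=> t /=; rewrite in_itv/= andbT => t0.
rewrite -EFinD lee_fin -mulrDl ler_pM2r ?expR_gt0//.
rewrite subrr powRr0 -natr1 addrK; have [t1|t1] := leP t 1.
  apply: (@le_trans _ _ 1); last by rewrite lerDl powR_ge0.
  by rewrite -[leRHS](powRr0 t); apply: ger_powR; rewrite ?t0//; lra.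
apply: (@le_trans _ _ (t `^ n%:R)); last by rewrite lerDr.
by apply: ler_powR; [exact: ltW|lra].
Qed.

(** The functional equation carries finiteness from a + 1 >= 1 back to a, which covers 0 < a < 1. *)
Lemma ext_Gamma_fin_num a : 0 < a -> ext_Gamma a \is a fin_num.
Proof.
move=> a0; rewrite ge0_fin_numE ?ext_Gamma_ge0//.
have : (ext_Gamma (a + 1) < +oo)%E by apply: ext_Gamma_ge1_lty; lra.
rewrite ext_Gamma_succ//; have := ext_Gamma_ge0 a.
by case: (ext_Gamma a) => [r _ _||]; rewrite ?ltry// gt0_muley.
Qed.

Lemma EFin_Gamma a : 0 < a -> (Gamma a)%:E = ext_Gamma a.
Proof. by move=> a0; rewrite /Gamma /Rintegral fineK//; exact: ext_Gamma_fin_num. Qed.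

Lemma Gamma_gt0 a : 0 < a -> 0 < Gamma a.
Proof. by move=> a0; rewrite -lte_fin EFin_Gamma// ext_Gamma_gt0. Qed.

Lemma Gamma_succ a : 0 < a -> Gamma (a + 1) = a * Gamma a.
Proof.
move=> a0; have a10 : 0 < a + 1 by rewrite addr_gt0.
by apply: EFin_inj; rewrite EFinM !EFin_Gamma// ext_Gamma_succ.
Qed.

Lemma ext_beta1E a b : 0 < a -> 0 < b ->
  ext_beta a b 1 = (Gamma a * Gamma b / Gamma (a + b))%:E.
Proof.
move=> a0 b0; have ab0 : 0 < a + b by rewrite addr_gt0.
have := ext_Gamma_mul a b; rewrite -!EFin_Gamma// => E.
transitivity ((Gamma (a + b))^-1%:E * ((Gamma (a + b))%:E * ext_beta a b 1))%E.
  by rewrite muleA -EFinM mulVf ?mul1e// lt0r_neq0// Gamma_gt0.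
by rewrite -E -!EFinM mulrC.
Qed.

Lemma ext_beta_fin_num a b x : 0 < a -> 0 < b -> x <= 1 ->
  ext_beta a b x \is a fin_num.
Proof.
move=> a0 b0 x1; rewrite ge0_fin_numE ?ext_beta_ge0//.
apply: (@le_lt_trans _ _ (ext_beta a b 1)); last by rewrite ext_beta1E// ltry.
apply: ge0_subset_integral => //.
- apply/measurable_EFinP; apply: measurable_funTS; apply: measurable_funM.
    exact: measurable_powR.
  by apply: (measurableT_comp (@measurable_powR R (b - 1))); exact: measurable_funB.
- by move=> t _; rewrite lee_fin mulr_ge0 ?powR_ge0.
- by move=> t /=; rewrite !in_itv/= => /andP[-> tx]; rewrite (lt_le_trans tx).
Qed.

Lemma EFin_beta_integral a b x : 0 < a -> 0 < b -> x <= 1 ->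
  (beta_integral a b x)%:E = ext_beta a b x.
Proof.
by move=> a0 b0 x1; rewrite /beta_integral /Rintegral fineK//; exact: ext_beta_fin_num.
Qed.

Lemma beta_integral1E a b : 0 < a -> 0 < b ->
  beta_integral a b 1 = Gamma a * Gamma b / Gamma (a + b).
Proof. by move=> a0 b0; apply: EFin_inj; rewrite EFin_beta_integral// ext_beta1E. Qed.

Lemma beta_integral_ge0 a b x : 0 <= beta_integral a b x.
Proof. by rewrite fine_ge0// ext_beta_ge0. Qed.

Lemma beta_integral_step p b x : 0 < p -> 0 < b -> 0 < x -> x <= 1 ->
  p * beta_integral p b x =
  (p + b) * beta_integral (p + 1) b x + x `^ p * (1 - x) `^ b.
Proof.
move=> p0 b0 x0 x1; apply: EFin_inj; rewrite EFinD !EFinM !EFin_beta_integral//.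
  exact: ext_beta_step.
by rewrite addr_gt0.
Qed.

(** The extra factor t is at most x on ]0, x[. This supplies the geometric decay of the remainder of
    the hypergeometric expansion. *)
Lemma beta_integral_succ_le p b x : 0 < p -> 0 < b -> 0 < x -> x <= 1 ->
  beta_integral (p + 1) b x <= x * beta_integral p b x.
Proof.
move=> p0 b0 x0 x1; have p10 : 0 < p + 1 by rewrite addr_gt0.
have mB c : measurable_fun `]0, x[ (fun t : R => (t `^ c * (1 - t) `^ (b - 1))%:E).
  apply/measurable_EFinP; apply: measurable_funTS; apply: measurable_funM.
    exact: measurable_powR.
  by apply: (measurableT_comp (@measurable_powR R (b - 1))); exact: measurable_funB.
have B0 c t : (0 <= (t `^ c * (1 - t) `^ (b - 1))%:E)%E.
  by rewrite lee_fin mulr_ge0 ?powR_ge0.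
rewrite -lee_fin EFinM !EFin_beta_integral// /ext_beta -ge0_integralZl//; last 2 first.
- exact: mB.
- by rewrite lee_fin ltW.
apply: ge0_le_integral; first by [].
- by move=> t _; exact: B0.
- exact: mB.
- by apply: measurable_funeM; exact: mB.
move=> t /=; rewrite in_itv/= => /andP[t0 tx].
rewrite -EFinM lee_fin mulrA ler_wpM2r ?powR_ge0// addrK.
by rewrite -(mulr_powRB1 (ltW t0) p0) ler_wpM2r ?powR_ge0// ltW.
Qed.

End Gamma_beta_values.

(** * Hypergeometric series for the incomplete beta integral *)

Section beta_hypergeometric.
Context {R : realType}.
Implicit Types a b p t x : R.

Lemma cvgn0_ratio (r : R^nat) (q : R) N : 0 <= q -> q < 1 ->
  (forall n, 0 <= r n) -> (forall n, (N <= n)%N -> r n.+1 <= q * r n) ->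
  r n @[n --> \oo] --> 0.
Proof.
move=> q0 q1 r0 rS; rewrite -(cvg_shiftn N).
have rN n : r (n + N)%N <= r N * q ^+ n.
  elim: n => [|n IH]; first by rewrite mulr1.
  apply: le_trans (rS _ (leq_addl _ _)) _.
  by rewrite exprS mulrCA ler_wpM2l.
apply: (@squeeze_cvgr _ _ _ _ (cst 0) (fun n => r N * q ^+ n)).
- by apply: nearW => n; rewrite r0 rN.
- exact: cvg_cst.
- rewrite -(mulr0 (r N)); apply: cvgMr; apply: cvg_expr.
  by rewrite ger0_norm.
Qed.

Lemma pochhammerS p n : pochhammer p n.+1 = pochhammer p n * (p + n%:R).
Proof. by rewrite /pochhammer big_nat_recr. Qed.

Lemma pochhammer_recl p n : pochhammer p n.+1 = p * pochhammer (p + 1) n.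
Proof.
rewrite /pochhammer big_nat_recl// addr0; congr (_ * _).
by apply: eq_bigr => k _; rewrite -addrA nat1r.
Qed.

Lemma pochhammer_gt0 p n : 0 < p -> 0 < pochhammer p n.
Proof.
move=> p0; rewrite /pochhammer; apply: prodr_gt0 => k _.
by rewrite ltr_wpDr.
Qed.

Lemma pochhammer1 n : pochhammer (1 : R) n = n`!%:R.
Proof.
by elim: n => [|n IH]; [rewrite /pochhammer big_nil|rewrite pochhammerS IH nat1r factS mulnC natrM].
Qed.

(** What is left of p B_x(p, b) after n uses of the recurrence. *)
Let remainder p b x n : R :=
  p * (pochhammer (p + b) n / pochhammer p n) * beta_integral (p + n%:R) b x.

(** The n-th term of 2F1(1, p+b; p+1; x), after cancelling (1)_n against n!. *)
Let coef p b x n : R := pochhammer (p + b) n / pochhammer (p + 1) n * x ^+ n.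

(** Induction on n: the recurrence at p + n splits the remainder into the next term of the series
    and the next remainder. *)
Let beta_expand p b x n : 0 < p -> 0 < b -> 0 < x -> x <= 1 ->
  p * beta_integral p b x =
  x `^ p * (1 - x) `^ b * series (coef p b x) n + remainder p b x n.
Proof.
move=> p0 b0 x0 x1; elim: n => [|n ->].
  by rewrite /series/= big_nil mulr0 add0r /remainder addr0 /pochhammer !big_nil divr1 mulr1.
rewrite seriesSr mulrDr -addrA; congr (_ + _).
have pn0 : 0 < p + n%:R by rewrite ltr_wpDr.
have E := beta_integral_step (p + n%:R) b x pn0 b0 x0 x1.
have : beta_integral (p + n%:R) b x = (p + n%:R)^-1 *
   ((p + n%:R + b) * beta_integral (p + n%:R + 1) b x + x `^ (p + n%:R) * (1 - x) `^ b).
  by rewrite -E mulKf// lt0r_neq0.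
rewrite /remainder /coef => ->.
rewrite powRD ?(lt0r_neq0 x0) ?implybT// powR_mulrn ?(ltW x0)//.
have P0 := pochhammer_gt0 p n p0.
have P1 : 0 < pochhammer (p + 1) n by apply: pochhammer_gt0; rewrite addr_gt0.
(* Both sides equal (p)_(n+1); this reconciles the denominators (p)_n of the remainder and (p+1)_n
   of the series. *)
have PE : p * pochhammer (p + 1) n = pochhammer p n * (p + n%:R).
  by rewrite -pochhammer_recl pochhammerS.
rewrite !pochhammerS -natr1 addrA.
have -> : pochhammer (p + 1) n = pochhammer p n * (p + n%:R) / p.
  by rewrite -PE mulrAC mulfV ?mul1r// lt0r_neq0.
field.
by rewrite !lt0r_neq0.
Qed.

(** Successive remainders have ratio at most x (p+b+n) / (p+n), which tends to x < 1; [q] is the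
    midpoint of x and 1. *)
Let remainder_cvg0 p b x : 0 < p -> 0 < b -> 0 < x -> x < 1 ->
  remainder p b x n @[n --> \oo] --> 0.
Proof.
move=> p0 b0 x0 x1; pose q := (1 + x) / 2.
have q1 : q < 1 by rewrite /q; lra.
have xq : x < q by rewrite /q; lra.
(* Beyond this bound x b < n (q - x), which forces x (p+b+n) <= q (p+n). *)
pose N := Num.bound (x * b / (q - x)).
apply: (cvgn0_ratio _ q N) => //; first by lra.
- move=> n; rewrite /remainder mulr_ge0 ?beta_integral_ge0// mulr_ge0 ?ltW//.
  by rewrite divr_gt0// pochhammer_gt0// addr_gt0.
move=> n Nn; have pn0 : 0 < p + n%:R by rewrite ltr_wpDr.
have P0 := pochhammer_gt0 p n p0.
have PB0 : 0 < pochhammer (p + b) n by rewrite pochhammer_gt0// addr_gt0.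
have c0 : 0 <= p * (pochhammer (p + b) n / pochhammer p n).
  by rewrite ltW// mulr_gt0// divr_gt0.
have Nb : x * b / (q - x) < n%:R.
  apply: (@lt_le_trans _ _ N%:R); last by rewrite ler_nat.
  by apply: archi_boundP; rewrite divr_ge0 ?mulr_ge0//; lra.
have B := beta_integral_succ_le (p + n%:R) b x pn0 b0 x0 (ltW x1).
have ratio : (p + b + n%:R) / (p + n%:R) * x <= q.
  rewrite mulrAC ler_pdivrMr//.
  have : x * b < n%:R * (q - x) by rewrite -ltr_pdivrMr// subr_gt0.
  have : 0 < p * (q - x) by rewrite mulr_gt0// subr_gt0.
  by nra.
rewrite /remainder !pochhammerS -natr1 addrA.
apply: (@le_trans _ _ (p * (pochhammer (p + b) n / pochhammer p n) *
    ((p + b + n%:R) / (p + n%:R) * x) * beta_integral (p + n%:R) b x)).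
  rewrite (_ : p * _ = p * (pochhammer (p + b) n / pochhammer p n) *
    ((p + b + n%:R) / (p + n%:R))); last by field; rewrite !lt0r_neq0.
  rewrite [leRHS](_ : _ = p * (pochhammer (p + b) n / pochhammer p n) *
    ((p + b + n%:R) / (p + n%:R)) * (x * beta_integral (p + n%:R) b x)); last by ring.
  apply: ler_wpM2l => //; rewrite mulr_ge0// divr_ge0 ?ltW// ltr_wpDr// addr_gt0//.
rewrite [leRHS]mulrA ler_wpM2r ?beta_integral_ge0// mulrC.
by rewrite ler_wpM2r.
Qed.

Lemma beta_integral_hyp2F1 p b x : 0 < p -> 0 < b -> 0 < x -> x < 1 ->
  p * beta_integral p b x =
  x `^ p * (1 - x) `^ b * hyp2F1 1 (p + b) (p + 1) x.
Proof.
move=> p0 b0 x0 x1; set K := x `^ p * (1 - x) `^ b.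
have K0 : 0 < K by rewrite mulr_gt0// powR_gt0// subr_gt0.
have -> : hyp2F1 1 (p + b) (p + 1) x = limn (series (coef p b x)).
  rewrite /hyp2F1 /pseries; congr (limn (series _)); apply/funext => n /=.
  rewrite /coef pochhammer1; congr (_ * _).
  have P1 : 0 < pochhammer (p + 1) n by apply: pochhammer_gt0; rewrite addr_gt0.
  have n0 : (0 : R) < n`!%:R by rewrite ltr0n fact_gt0.
  by field; rewrite !lt0r_neq0.
(* Solving the finite expansion for the partial sums reduces convergence of the series to that of
   the remainder. *)
have -> : series (coef p b x) =
    (fun n => K^-1 * (p * beta_integral p b x - remainder p b x n)).
  apply/funext => n.
  by rewrite (beta_expand p b x n)// ?ltW// addrK mulKf// lt0r_neq0.
have L : K^-1 * (p * beta_integral p b x - remainder p b x n) @[n --> \oo] -->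
    K^-1 * (p * beta_integral p b x - 0).
  apply: cvgMr; apply: cvgB; [exact: cvg_cst|exact: remainder_cvg0].
by rewrite (cvg_lim _ L)// subr0 mulVKf// lt0r_neq0.
Qed.

End beta_hypergeometric.

(** * The normalized function at consecutive parameters, and one telescoping difference *)

Section reg_inc_beta_steps.
Context {R : realType}.
Variables (b x : R).
Hypotheses (b0 : 0 < b) (x0 : 0 < x) (x1 : x < 1).
Implicit Types p u : R.

(** This is 1 / (p B(p, b)), with B(p, b) the complete beta integral. *)
Let K p := Gamma (p + b) / (Gamma (p + 1) * Gamma b).
(** D_j is a difference of two values of [G]; x G(p) is 2F1(1, p+b; p+1; x) without its constant
    term. *)
Let G p := (p + b) / (p + 1) * hyp2F1 1 (p + b + 1) (p + 2) x.

Lemma reg_inc_beta_step p : 0 < p ->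
  reg_inc_beta p b x = reg_inc_beta (p + 1) b x + K p * (x `^ p * (1 - x) `^ b).
Proof.
move=> p0; have p10 : 0 < p + 1 by rewrite addr_gt0.
have pb0 : 0 < p + b by rewrite addr_gt0.
have := beta_integral_step p b x p0 b0 x0 (ltW x1).
rewrite /reg_inc_beta !beta_integral1E// /K Gamma_succ//.
rewrite (_ : p + 1 + b = p + b + 1); last by ring.
rewrite Gamma_succ// => E.
have -> : beta_integral p b x =
    ((p + b) * beta_integral (p + 1) b x + x `^ p * (1 - x) `^ b) / p.
  by rewrite -E mulrAC mulfV ?mul1r// lt0r_neq0.
field; rewrite !lt0r_neq0 ?Gamma_gt0//.
Qed.

(** The hypergeometric formula is used at p + 1, so that the prefactor K(p) x^p (1-x)^b matches that
    of [reg_inc_beta_step]; the factor x comes from x^(p+1). *)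
Lemma reg_inc_beta_hyp2F1 p : 0 < p ->
  reg_inc_beta (p + 1) b x = K p * (x `^ p * (1 - x) `^ b) * (x * G p).
Proof.
move=> p0; have p10 : 0 < p + 1 by rewrite addr_gt0.
have pb0 : 0 < p + b by rewrite addr_gt0.
have := beta_integral_hyp2F1 (p + 1) b x p10 b0 x0 x1.
rewrite /reg_inc_beta !beta_integral1E// /K /G.
rewrite (_ : p + 1 + b = p + b + 1); last by ring.
rewrite (_ : p + 1 + 1 = p + 2); last by ring.
rewrite [Gamma (p + b + 1)]Gamma_succ// => E.
have -> : beta_integral (p + 1) b x =
    x `^ (p + 1) * (1 - x) `^ b * hyp2F1 1 (p + b + 1) (p + 2) x / (p + 1).
  by rewrite -E mulrAC mulfV ?mul1r// lt0r_neq0.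
rewrite powRD ?(lt0r_neq0 x0) ?implybT// powRr1 ?(ltW x0)//.
have := Gamma_gt0 b b0; have := Gamma_gt0 (p + b) pb0; have := Gamma_gt0 (p + 1) p10.
move: (Gamma b) (Gamma (p + b)) (Gamma (p + 1)) (hyp2F1 _ _ _ _) (powR _ _) (powR _ _).
move=> g1 g2 g3 h y z g30 g20 g10.
by field; rewrite !lt0r_neq0.
Qed.

(** With k(p) = K(p) x^p (1-x)^b, I(p+1) = k(p) x G(p) and I(p) = k(p) (1 + x G(p)). In the
    difference the terms x^2 G(p) G(u) cancel, leaving k(p) k(u) x (G(p) - G(u)). *)
Lemma reg_inc_beta_cross p u : 0 < p -> 0 < u ->
  reg_inc_beta (p + 1) b x * reg_inc_beta u b x
  - reg_inc_beta p b x * reg_inc_beta (u + 1) b x =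
  Gamma (p + b) * Gamma (u + b) / (Gamma b ^+ 2 * Gamma (p + 1) * Gamma (u + 1))
  * ((p + b) / (p + 1) * hyp2F1 1 (p + b + 1) (p + 2) x
     - (u + b) / (u + 1) * hyp2F1 1 (u + b + 1) (u + 2) x)
  * (x `^ (p + u + 1) * (1 - x) `^ (2 * b)).
Proof.
move=> p0 u0; rewrite (reg_inc_beta_step p p0) (reg_inc_beta_step u u0).
rewrite (reg_inc_beta_hyp2F1 p p0) (reg_inc_beta_hyp2F1 u u0) -/(G p) -/(G u) /K.
rewrite (_ : 2 * b = b + b); last by ring.
rewrite !powRD ?(lt0r_neq0 x0) ?subr_eq0 ?(gt_eqF x1) ?implybT// powRr1 ?(ltW x0)//.
have : 0 < Gamma b by exact: Gamma_gt0.
have : 0 < Gamma (p + 1) by apply: Gamma_gt0; rewrite addr_gt0.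
have : 0 < Gamma (u + 1) by apply: Gamma_gt0; rewrite addr_gt0.
move: (Gamma b) (Gamma (p + b)) (Gamma (u + b)) (Gamma (p + 1)) (Gamma (u + 1)).
move: (G p) (G u) (powR x p) (powR x u) (powR (1 - x) b).
move=> Gp Gu xp xu y gb gpb gub gp gu gu0 gp0 gb0.
by field; rewrite !lt0r_neq0.
Qed.

End reg_inc_beta_steps.

(** * Telescoping the numerator *)

Theorem theorem3 (R : realType) (alpha : nat) (a b beta x : R)
    (halpha : (0 < alpha)%N) (ha : 0 < a) (hb : 0 < b) (hbeta : 0 < beta)
    (hx0 : 0 < x) (hx1 : x < 1) :
  psi a b alpha%:R beta x
    / (x `^ (2 * a + alpha%:R + beta) * (1 - x) `^ (2 * b))
  = \sum_(0 <= j < alpha)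
      Gamma (a + b + j%:R) * Gamma (a + b + beta + alpha%:R - j%:R - 1)
      / (Gamma b ^+ 2 * Gamma (a + j%:R + 1)
         * Gamma (a + beta + alpha%:R - j%:R))
      * D_term a b alpha%:R beta j x.
Proof.
set c := x `^ _ * _.
have c0 : c != 0 by rewrite mulf_neq0// lt0r_neq0// powR_gt0// subr_gt0.
apply: (mulIf c0); rewrite mulfVK// mulr_suml.
(* One parameter rises while the other falls: the products of [psi] are T(alpha) and T(0), and each
   increment T(j+1) - T(j) is a cross difference. *)
pose T j := reg_inc_beta (a + j%:R) b x * reg_inc_beta (a + beta + alpha%:R - j%:R) b x.
have -> : psi a b alpha%:R beta x = T alpha - T 0.
  rewrite /psi /T subr0 addr0 addrK.
  by rewrite (_ : a + beta + alpha%:R = a + alpha%:R + beta)//; ring.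
rewrite -telescope_sumr//; apply: eq_big_nat => j /andP[_ ja].
have jal : j%:R + 1 <= alpha%:R :> R by rewrite natr1 ler_nat.
have j0 : 0 <= j%:R :> R by [].
(* [u] is shifted by -1 because T(j) contains I(u+1) and T(j+1) contains I(u); j + 1 <= alpha gives
   u >= a + beta > 0. *)
pose p := a + j%:R; pose u := a + beta + alpha%:R - j%:R - 1.
have p0 : 0 < p by rewrite ltr_wpDr.
have u0 : 0 < u by rewrite /u; lra.
have := reg_inc_beta_cross b x hb hx0 hx1 p u p0 u0.
rewrite /T /c /D_term -[j.+1%:R]natr1.
rewrite (_ : a + beta + alpha%:R - (j%:R + 1) = u); last by rewrite /u; ring.
rewrite (_ : a + beta + alpha%:R - j%:R = u + 1); last by rewrite /u; ring.
rewrite (_ : a + (j%:R + 1) = p + 1); last by rewrite /p; ring.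
rewrite (_ : 2 * a + alpha%:R + beta = p + u + 1); last by rewrite /p /u; ring.
rewrite (_ : a + b + beta + alpha%:R - j%:R - 1 = u + b); last by rewrite /u; ring.
rewrite (_ : a + b + beta + alpha%:R - 1 - j%:R = u + b); last by rewrite /u; ring.
rewrite (_ : a + b + beta + alpha%:R - j%:R = u + b + 1); last by rewrite /u; ring.
rewrite (_ : a + b + j%:R = p + b); last by rewrite /p; ring.
rewrite (_ : u + 1 + 1 = u + 2); last by ring.
by move=> ->.
Qed.
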